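(* Let $(A,d)$ be a difference algebra and $((M_1\xrightarrow{\delta}M_0,\nu),\Delta_0,\Delta_1,\theta)$ be a $2$-term bimodule up to homotopy over it. Then $$\big((C=(A\oplus M_0\oplus M_1\rightrightarrows A\oplus M_0),\bullet,\mathcal{A}),D,\mathcal{D}\big)$$ is a difference associative $2$-algebra, where the structure operations are given by $$s(a,u,\xi)=(a,u),\qquad t(a,u,\xi)=(a,u+\delta(\xi)),\qquad i_{(a,u)}=(a,u,0),$$ the composite of a composable pair (first $(a,u,\xi)$, then $(b,v,\eta)$, with $t(a,u,\xi)=s(b,v,\eta)$) is $(a,u,\xi+\eta)$, $$(a,u,\xi)\bullet(b,v,\eta)=(ab,\ av+ub,\ a\eta+\xi b)\quad\text{on morphisms},\qquad(a,u)\bullet(b,v)=(ab,\ av+ub)\quad\text{on objects},$$ $$\mathcal{A}_{(a,u),(b,v),(c,w)}=\big(abc,\ (ab)w+(av)c+(ub)c,\ \nu(a,b,w)+\nu(a,v,c)+\nu(u,b,c)\big),$$ $$D_0(a,u)=(d(a),\Delta_0(u)),\qquad D_1(a,u,\xi)=(d(a),\Delta_0(u),\Delta_1(\xi)),$$ $$\mathcal{D}_{(a,u),(b,v)}=\big(d(ab),\ \Delta_0(av+ub),\ \theta(a,v)+\theta(u,b)\big),$$ for $(a,u),(b,v),(c,w)\in A\oplus M_0$ and $\xi,\eta\in M_1$.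
   Context: All vector spaces are over a field $\mathbf{k}$ of characteristic $0$. A difference algebra $(A,d)$ is an associative algebra $A$ (not assumed unital) with a linear map $d:A\to A$ satisfying $d(ab)=d(a)b+ad(b)+d(a)d(b)$. **2-vector spaces.** A 2-vector space is a category $C=(C_1\rightrightarrows C_0)$ internal to vector spaces: the objects $C_0$ and morphisms $C_1$ form vector spaces, and the source and target maps $s,t:C_1\to C_0$, the identity-assigning map $i:C_0\to C_1$, $x\mapsto i_x$ (also written $1$ or $1_x$), and the composition $C_1\times_{C_0}C_1\to C_1$ are linear. In this context $g\circ f$ means first $f$, then $g$. A linear functor $C\to C'$ is a pair $(F_0,F_1)$ of linear maps $F_0:C_0\to C_0'$, $F_1:C_1\to C_1'$ compatible with all the structure maps. A bilinear functor $\bullet:C\times C\to C$ is a functor that is bilinear on objects and on morphisms. A natural isomorphism is called bilinear (trilinear) if its components depend bilinearly (trilinearly) on the objects. **Difference associative 2-algebras.** An associative $2$-algebra $(C,\bullet,\mathcal{A})$ is a 2-vector space $C$ with a bilinear functor $\bullet:C\times C\to C$ and a trilinear natural isomorphism $\mathcal{A}_{x,y,z}:(x\bullet y)\bullet z\to x\bullet(y\bullet z)$ such that for all objects $x,y,z,t$ $$(1_x\bullet\mathcal{A}_{y,z,t})\circ\mathcal{A}_{x,y\bullet z,t}\circ(\mathcal{A}_{x,y,z}\bullet 1_t)=\mathcal{A}_{x,y,z\bullet t}\circ\mathcal{A}_{x\bullet y,z,t}.$$ A difference operator on $(C,\bullet,\mathcal{A})$ is a linear functor $D=(D_0,D_1):C\to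 C$ with a bilinear natural isomorphism $$\mathcal{D}_{x,y}:D_0(x\bullet y)\to D_0(x)\bullet y+x\bullet D_0(y)+D_0(x)\bullet D_0(y)$$ such that for all objects $x,y,z$ the following two morphisms out of $D_0((x\bullet y)\bullet z)$ are equal: $$\big(\mathcal{A}_{D_0(x),y,z}+\mathcal{A}_{x,D_0(y),z}+\mathcal{A}_{D_0(x),D_0(y),z}+\mathcal{A}_{x,y,D_0(z)}+\mathcal{A}_{D_0(x),y,D_0(z)}+\mathcal{A}_{x,D_0(y),D_0(z)}+\mathcal{A}_{D_0(x),D_0(y),D_0(z)}\big)\circ\big(\mathcal{D}_{x,y}\bullet 1_z+1_{(x\bullet y)\bullet D_0(z)}+\mathcal{D}_{x,y}\bullet 1_{D_0(z)}\big)\circ\mathcal{D}_{x\bullet y,z}$$ and $$\big(1_{D_0(x)\bullet(y\bullet z)}+1_x\bullet\mathcal{D}_{y,z}+1_{D_0(x)}\bullet\mathcal{D}_{y,z}\big)\circ\mathcal{D}_{x,y\bullet z}\circ D_1(\mathcal{A}_{x,y,z}).$$ The tuple $((C,\bullet,\mathcal{A}),D,\mathcal{D})$ is called a difference associative $2$-algebra. **2-term bimodules up to homotopy of an associative algebra.** Let $A$ be an associative algebra. A $2$-term bimodule up to homotopy of $A$, denoted $(M_1\xrightarrow{\delta}M_0,\nu)$, consists of a linear map $\delta:M_1\to M_0$ of vector spaces; four bilinear maps $A\times M_0\to M_0$, $(a,v)\mapsto av$; $M_0\times A\to M_0$, $(v,a)\mapsto va$; $A\times M_1\to M_1$, $(a,\xi)\mapsto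 a\xi$; $M_1\times A\to M_1$, $(\xi,a)\mapsto\xi a$, satisfying $\delta(a\xi)=a\delta(\xi)$ and $\delta(\xi a)=\delta(\xi)a$; and three trilinear maps, all denoted $\nu$, $$\nu:A\times A\times M_0\to M_1,\quad\nu:A\times M_0\times A\to M_1,\quad\nu:M_0\times A\times A\to M_1,$$ such that for all $a,b,c\in A$, $v\in M_0$, $\xi\in M_1$: $a(bv)-(ab)v=\delta(\nu(a,b,v))$, $\ a(vb)-(av)b=\delta(\nu(a,v,b))$, $\ v(ab)-(va)b=\delta(\nu(v,a,b))$; $a(b\xi)-(ab)\xi=\nu(a,b,\delta(\xi))$, $\ a(\xi b)-(a\xi)b=\nu(a,\delta(\xi),b)$, $\ \xi(ab)-(\xi a)b=\nu(\delta(\xi),a,b)$; $a\,\nu(b,c,v)-\nu(ab,c,v)+\nu(a,bc,v)-\nu(a,b,cv)=0$; $a\,\nu(b,v,c)-\nu(ab,v,c)+\nu(a,bv,c)-\nu(a,b,vc)+\nu(a,b,v)\,c=0$; $a\,\nu(v,b,c)-\nu(av,b,c)+\nu(a,vb,c)-\nu(a,v,bc)+\nu(a,v,b)\,c=0$; $\nu(va,b,c)-\nu(v,ab,c)+\nu(v,a,bc)-\nu(v,a,b)\,c=0$. **2-term bimodules up to homotopy over a difference algebra.** A $2$-term bimodule up to homotopy over a difference algebra $(A,d)$ is a tuple $((M_1\xrightarrow{\delta}M_0,\nu),\Delta_0,\Delta_1,\theta)$, where $(M_1\xrightarrow{\delta}M_0,\nu)$ is a $2$-term bimodule up to homotopy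 of the associative algebra $A$; $\Delta_0:M_0\to M_0$ and $\Delta_1:M_1\to M_1$ are linear maps with $\Delta_0\circ\delta=\delta\circ\Delta_1$; and there are two bilinear maps, both denoted $\theta$, $\theta:A\times M_0\to M_1$ and $\theta:M_0\times A\to M_1$, such that for all $a,b\in A$, $v\in M_0$, $\xi\in M_1$: $d(a)v+a\Delta_0(v)+d(a)\Delta_0(v)-\Delta_0(av)=\delta(\theta(a,v))$; $\Delta_0(v)a+vd(a)+\Delta_0(v)d(a)-\Delta_0(va)=\delta(\theta(v,a))$; $d(a)\xi+a\Delta_1(\xi)+d(a)\Delta_1(\xi)-\Delta_1(a\xi)=\theta(a,\delta(\xi))$; $\Delta_1(\xi)a+\xi d(a)+\Delta_1(\xi)d(a)-\Delta_1(\xi a)=\theta(\delta(\xi),a)$; $(a+d(a))\theta(b,v)-\theta(ab,v)+\theta(a,bv)=\nu(d(a),b,v)+\nu(a,d(b),v)+\nu(a,b,\Delta_0(v))+\nu(d(a),d(b),v)+\nu(d(a),b,\Delta_0(v))+\nu(a,d(b),\Delta_0(v))+\nu(d(a),d(b),\Delta_0(v))-\Delta_1(\nu(a,b,v))$; $(a+d(a))\theta(v,b)-\theta(av,b)+\theta(a,vb)-\theta(a,v)(b+d(b))=\nu(d(a),v,b)+\nu(a,\Delta_0(v),b)+\nu(a,v,d(b))+\nu(d(a),\Delta_0(v),b)+\nu(d(a),v,d(b))+\nu(a,\Delta_0(v),d(b))+\nu(d(a),\Delta_0(v),d(b))-\Delta_1(\nu(a,v,b))$; $-\theta(va,b)+\theta(v,ab)-\theta(v,a)(b+d(b))=\nu(\Delta_0(v),a,b)+\nu(v,d(a),b)+\nu(v,a,d(b))+\nu(\Delta_0(v),d(a),b)+\nu(\Delta_0(v),a,d(b))+\nu(v,d(a),d(b))+\nu(\Delta_0(v),d(a),d(b))-\Delta_1(\nu(v,a,b))$.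 *)

(* Defs.v *)
From mathcomp Require Import all_boot all_order all_algebra.

Set Implicit Arguments.
Unset Strict Implicit.
Unset Printing Implicit Defensive.

Import GRing.Theory.
Local Open Scope ring_scope.

Definition trilinear (k : fieldType) (U V W X : lmodType k)
    (f : U -> V -> W -> X) : Prop :=
  [/\ forall v w, linear (fun u => f u v w),
      forall u w, linear (fun v => f u v w) &
      forall u v, linear (fun w => f u v w)].

(** * Difference algebras and their 2-term bimodules up to homotopy *)

(* MathComp rings are unital, hence this record. *)
Record assocAlg (k : fieldType) := AssocAlg {
  aa_sort :> lmodType k;
  amul : {bilinear aa_sort -> aa_sort -> aa_sort};
  amulA : associative amul
}.

Record diffAlg (k : fieldType) := DiffAlg {
  da_alg :> assocAlg k;
  dop : {linear da_alg -> da_alg};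
  dopM : forall a b : da_alg,
    dop (amul da_alg a b) = amul da_alg (dop a) b + amul da_alg a (dop b)
                            + amul da_alg (dop a) (dop b)
}.

(* The suffixes record the types of the arguments: [lact] is A x M -> M and
   [ract] is M x A -> M; [nuR], [nuM], [nuL] are the three maps nu whose
   module argument is the right, middle, left one; likewise [thR], [thL]. *)
Record bimod2 (k : fieldType) (A : assocAlg k) := Bimod2 {
  M0 : lmodType k;
  M1 : lmodType k;
  delta : {linear M1 -> M0};
  lact0 : {bilinear A -> M0 -> M0};
  ract0 : {bilinear M0 -> A -> M0};
  lact1 : {bilinear A -> M1 -> M1};
  ract1 : {bilinear M1 -> A -> M1};
  delta_lact : forall a xi, delta (lact1 a xi) = lact0 a (delta xi);
  delta_ract : forall xi a, delta (ract1 xi a) = ract0 (delta xi) a;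
  nuR : A -> A -> M0 -> M1;
  nuM : A -> M0 -> A -> M1;
  nuL : M0 -> A -> A -> M1;
  nuR_trilinear : trilinear nuR;
  nuM_trilinear : trilinear nuM;
  nuL_trilinear : trilinear nuL;
  delta_nuR : forall a b v,
    lact0 a (lact0 b v) - lact0 (amul A a b) v = delta (nuR a b v);
  delta_nuM : forall a v b,
    lact0 a (ract0 v b) - ract0 (lact0 a v) b = delta (nuM a v b);
  delta_nuL : forall v a b,
    ract0 v (amul A a b) - ract0 (ract0 v a) b = delta (nuL v a b);
  nuR_delta : forall a b xi,
    lact1 a (lact1 b xi) - lact1 (amul A a b) xi = nuR a b (delta xi);
  nuM_delta : forall a xi b,
    lact1 a (ract1 xi b) - ract1 (lact1 a xi) b = nuM a (delta xi) b;
  nuL_delta : forall xi a b,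
    ract1 xi (amul A a b) - ract1 (ract1 xi a) b = nuL (delta xi) a b;
  nu_AAAM : forall a b c v,
    lact1 a (nuR b c v) - nuR (amul A a b) c v + nuR a (amul A b c) v
      - nuR a b (lact0 c v) = 0;
  nu_AAMA : forall a b v c,
    lact1 a (nuM b v c) - nuM (amul A a b) v c + nuM a (lact0 b v) c
      - nuR a b (ract0 v c) + ract1 (nuR a b v) c = 0;
  nu_AMAA : forall a v b c,
    lact1 a (nuL v b c) - nuL (lact0 a v) b c + nuM a (ract0 v b) c
      - nuM a v (amul A b c) + ract1 (nuM a v b) c = 0;
  nu_MAAA : forall v a b c,
    nuL (ract0 v a) b c - nuL v (amul A a b) c + nuL v a (amul A b c)
      - ract1 (nuL v a b) c = 0
}.

Record diffBimod2 (k : fieldType) (A : diffAlg k) := DiffBimod2 {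
  db_bimod :> bimod2 A;
  Delta0 : {linear M0 db_bimod -> M0 db_bimod};
  Delta1 : {linear M1 db_bimod -> M1 db_bimod};
  Delta_delta : forall xi,
    Delta0 (delta db_bimod xi) = delta db_bimod (Delta1 xi);
  thR : {bilinear A -> M0 db_bimod -> M1 db_bimod};
  thL : {bilinear M0 db_bimod -> A -> M1 db_bimod};
  delta_thR : forall a v,
    lact0 db_bimod (dop A a) v + lact0 db_bimod a (Delta0 v)
      + lact0 db_bimod (dop A a) (Delta0 v) - Delta0 (lact0 db_bimod a v)
    = delta db_bimod (thR a v);
  delta_thL : forall v a,
    ract0 db_bimod (Delta0 v) a + ract0 db_bimod v (dop A a)
      + ract0 db_bimod (Delta0 v) (dop A a) - Delta0 (ract0 db_bimod v a)
    = delta db_bimod (thL v a);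
  thR_delta : forall a xi,
    lact1 db_bimod (dop A a) xi + lact1 db_bimod a (Delta1 xi)
      + lact1 db_bimod (dop A a) (Delta1 xi) - Delta1 (lact1 db_bimod a xi)
    = thR a (delta db_bimod xi);
  thL_delta : forall xi a,
    ract1 db_bimod (Delta1 xi) a + ract1 db_bimod xi (dop A a)
      + ract1 db_bimod (Delta1 xi) (dop A a) - Delta1 (ract1 db_bimod xi a)
    = thL (delta db_bimod xi) a;
  th_AAM : forall a b v,
    lact1 db_bimod (a + dop A a) (thR b v) - thR (amul A a b) v
      + thR a (lact0 db_bimod b v)
    = nuR (dop A a) b v + nuR a (dop A b) v + nuR a b (Delta0 v)
      + nuR (dop A a) (dop A b) v + nuR (dop A a) b (Delta0 v)
      + nuR a (dop A b) (Delta0 v) + nuR (dop A a) (dop A b) (Delta0 v)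
      - Delta1 (nuR a b v);
  th_AMA : forall a v b,
    lact1 db_bimod (a + dop A a) (thL v b) - thL (lact0 db_bimod a v) b
      + thR a (ract0 db_bimod v b) - ract1 db_bimod (thR a v) (b + dop A b)
    = nuM (dop A a) v b + nuM a (Delta0 v) b + nuM a v (dop A b)
      + nuM (dop A a) (Delta0 v) b + nuM (dop A a) v (dop A b)
      + nuM a (Delta0 v) (dop A b) + nuM (dop A a) (Delta0 v) (dop A b)
      - Delta1 (nuM a v b);
  th_MAA : forall v a b,
    - thL (ract0 db_bimod v a) b + thL v (amul A a b)
      - ract1 db_bimod (thL v a) (b + dop A b)
    = nuL (Delta0 v) a b + nuL v (dop A a) b + nuL v a (dop A b)
      + nuL (Delta0 v) (dop A a) b + nuL (Delta0 v) a (dop A b)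
      + nuL v (dop A a) (dop A b) + nuL (Delta0 v) (dop A a) (dop A b)
      - Delta1 (nuL v a b)
}.

(** * 2-vector spaces *)

(* The [...Data] records carry structure only; the axioms are the
   corresponding [is_...] predicates. *)
Record twoVectData (k : fieldType) := TwoVectData {
  ob : lmodType k;
  mor : lmodType k;
  src : mor -> ob;
  tgt : mor -> ob;
  idm : ob -> mor;
  vcomp : forall g f : mor, tgt f = src g -> mor
}.
Arguments idm {k} C x : rename.
Arguments vcomp {k C g f} _ : rename.

(* Composition "first f, then g" extended by 0 to pairs that are not
   composable; it is only ever used on composable ones. *)
Definition compo (k : fieldType) (C : twoVectData k) (g f : mor C) : mor C :=
  if tgt f =P src g is ReflectT gf then vcomp gf else 0.

Record is_twoVect (k : fieldType) (C : twoVectData k) : Prop := IsTwoVect {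
  src_linear : linear (@src k C);
  tgt_linear : linear (@tgt k C);
  idm_linear : linear (idm C);
  src_idm : forall x, src (idm C x) = x;
  tgt_idm : forall x, tgt (idm C x) = x;
  src_compo : forall g f : mor C, tgt f = src g -> src (compo g f) = src f;
  tgt_compo : forall g f : mor C, tgt f = src g -> tgt (compo g f) = tgt g;
  (* linearity on the pullback C_1 x_(C_0) C_1 *)
  compo_linear : forall (a : k) (g f g' f' : mor C),
    tgt f = src g -> tgt f' = src g' ->
    compo (a *: g + g') (a *: f + f') = a *: compo g f + compo g' f';
  compo_idr : forall f : mor C, compo f (idm C (src f)) = f;
  compo_idl : forall f : mor C, compo (idm C (tgt f)) f = f;
  compoA : forall h g f : mor C, tgt f = src g -> tgt g = src h ->
    compo h (compo g f) = compo (compo h g) f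
}.

Definition prodTwoVect (k : fieldType) (C C' : twoVectData k) : twoVectData k :=
  @TwoVectData k (ob C * ob C')%type (mor C * mor C')%type
    (fun f => (src f.1, src f.2))
    (fun f => (tgt f.1, tgt f.2))
    (fun x => (idm C x.1, idm C' x.2))
    (fun g f gf => (vcomp (congr1 fst gf), vcomp (congr1 snd gf))).

Record functorData (k : fieldType) (C C' : twoVectData k) := FunctorData {
  fob : ob C -> ob C';
  fmor : mor C -> mor C'
}.
Arguments FunctorData {k C C'} fob fmor.

Record is_functor (k : fieldType) (C C' : twoVectData k)
    (F : functorData C C') : Prop := IsFunctor {
  fmor_src : forall f, src (fmor F f) = fob F (src f);
  fmor_tgt : forall f, tgt (fmor F f) = fob F (tgt f);
  fmor_idm : forall x, fmor F (idm C x) = idm C' (fob F x);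
  fmor_compo : forall g f : mor C, tgt f = src g ->
    fmor F (compo g f) = compo (fmor F g) (fmor F f)
}.

Definition is_linear_functor (k : fieldType) (C C' : twoVectData k)
    (F : functorData C C') : Prop :=
  [/\ is_functor F, linear (fob F) & linear (fmor F)].

Definition is_bilinear_functor (k : fieldType) (C C' C'' : twoVectData k)
    (F : functorData (prodTwoVect C C') C'') : Prop :=
  [/\ is_functor F,
      bilinear_for *:%R *:%R (fun x y => fob F (x, y)) &
      bilinear_for *:%R *:%R (fun f g => fmor F (f, g))].

Record is_natural_iso (k : fieldType) (C C' : twoVectData k)
    (F G : functorData C C') (alpha : ob C -> mor C') : Prop := IsNaturalIso {
  nat_src : forall x, src (alpha x) = fob F x;
  nat_tgt : forall x, tgt (alpha x) = fob G x;
  nat_square : forall f : mor C,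
    compo (fmor G f) (alpha (src f)) = compo (alpha (tgt f)) (fmor F f);
  nat_iso : forall x, exists g : mor C',
    [/\ src g = fob G x, tgt g = fob F x,
        compo g (alpha x) = idm C' (fob F x) &
        compo (alpha x) g = idm C' (fob G x)]
}.

(** * Associative 2-algebras and difference operators *)

Record assoc2Data (k : fieldType) := Assoc2Data {
  a2_cat :> twoVectData k;
  bul : functorData (prodTwoVect a2_cat a2_cat) a2_cat;
  assoc : ob a2_cat -> ob a2_cat -> ob a2_cat -> mor a2_cat
}.

Section Assoc2.
Variables (k : fieldType) (C : assoc2Data k).

Definition bul0 (x y : ob C) : ob C := fob (bul C) (x, y).
Definition bul1 (f g : mor C) : mor C := fmor (bul C) (f, g).

Definition bul_l : functorData (prodTwoVect (prodTwoVect C C) C) C :=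
  @FunctorData k (prodTwoVect (prodTwoVect C C) C) C
    (fun p => bul0 (bul0 p.1.1 p.1.2) p.2)
    (fun p => bul1 (bul1 p.1.1 p.1.2) p.2).

Definition bul_r : functorData (prodTwoVect (prodTwoVect C C) C) C :=
  @FunctorData k (prodTwoVect (prodTwoVect C C) C) C
    (fun p => bul0 p.1.1 (bul0 p.1.2 p.2))
    (fun p => bul1 p.1.1 (bul1 p.1.2 p.2)).

Record is_assoc2 : Prop := IsAssoc2 {
  a2_twoVect : is_twoVect C;
  a2_bul : is_bilinear_functor (bul C);
  a2_trilinear : trilinear (@assoc k C);
  a2_natural : is_natural_iso bul_l bul_r (fun p => assoc p.1.1 p.1.2 p.2);
  a2_pentagon : forall x y z t : ob C,
    compo (bul1 (idm C x) (assoc y z t))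
      (compo (assoc x (bul0 y z) t) (bul1 (assoc x y z) (idm C t)))
    = compo (assoc x y (bul0 z t)) (assoc (bul0 x y) z t)
}.

End Assoc2.

Record diff2Data (k : fieldType) := Diff2Data {
  d2_alg :> assoc2Data k;
  Dop : functorData d2_alg d2_alg;
  Dnat : ob d2_alg -> ob d2_alg -> mor d2_alg
}.

Section Diff2.
Variables (k : fieldType) (C : diff2Data k).

Local Notation D0 := (fob (Dop C)).
Local Notation D1 := (fmor (Dop C)).
Local Notation one := (idm C).

Definition D_bul : functorData (prodTwoVect C C) C :=
  @FunctorData k (prodTwoVect C C) C
    (fun p => D0 (bul0 p.1 p.2))
    (fun p => D1 (bul1 p.1 p.2)).

Definition bul_D : functorData (prodTwoVect C C) C :=
  @FunctorData k (prodTwoVect C C) C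
    (fun p => bul0 (D0 p.1) p.2 + bul0 p.1 (D0 p.2) + bul0 (D0 p.1) (D0 p.2))
    (fun p => bul1 (D1 p.1) p.2 + bul1 p.1 (D1 p.2) + bul1 (D1 p.1) (D1 p.2)).

Record is_diff_operator : Prop := IsDiffOperator {
  d2_linear : is_linear_functor (Dop C);
  d2_bilinear : bilinear_for *:%R *:%R (@Dnat k C);
  d2_natural : is_natural_iso D_bul bul_D (fun p => Dnat p.1 p.2);
  d2_coherence : forall x y z : ob C,
    compo (assoc (D0 x) y z + assoc x (D0 y) z + assoc (D0 x) (D0 y) z
           + assoc x y (D0 z) + assoc (D0 x) y (D0 z) + assoc x (D0 y) (D0 z)
           + assoc (D0 x) (D0 y) (D0 z))
      (compo (bul1 (Dnat x y) (one z) + one (bul0 (bul0 x y) (D0 z))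
              + bul1 (Dnat x y) (one (D0 z)))
        (Dnat (bul0 x y) z))
    = compo (one (bul0 (D0 x) (bul0 y z)) + bul1 (one x) (Dnat y z)
             + bul1 (one (D0 x)) (Dnat y z))
        (compo (Dnat x (bul0 y z)) (D1 (assoc x y z)))
}.

Definition is_diff_assoc2 : Prop := is_assoc2 C /\ is_diff_operator.

End Diff2.

(** * The construction on A + M_0 + M_1 => A + M_0 *)

Section Semidirect.
Variables (k : fieldType) (A : diffAlg k) (M : diffBimod2 A).

Local Notation "a ** b" := (amul A a b) (at level 40, left associativity).
Local Notation "a |> u" := (lact0 M a u) (at level 40, left associativity).
Local Notation "u <| a" := (ract0 M u a) (at level 40, left associativity).

Definition semidirect_cat : twoVectData k :=
  @TwoVectData k (A * M0 M)%type (A * M0 M * M1 M)%type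
    (fun '(a, u, xi) => (a, u))
    (fun '(a, u, xi) => (a, u + delta M xi))
    (fun '(a, u) => (a, u, 0))
    (fun g f _ => (f.1, f.2 + g.2)).

Definition semidirect_bul :
    functorData (prodTwoVect semidirect_cat semidirect_cat) semidirect_cat :=
  @FunctorData k (prodTwoVect semidirect_cat semidirect_cat) semidirect_cat
    (fun '((a, u), (b, v)) => (a ** b, a |> v + u <| b))
    (fun '((a, u, xi), (b, v, eta)) =>
       (a ** b, a |> v + u <| b, lact1 M a eta + ract1 M xi b)).

Definition semidirect_assoc (x y z : A * M0 M) : A * M0 M * M1 M :=
  let: (a, u) := x in let: (b, v) := y in let: (c, w) := z in
  (a ** b ** c,
   (a ** b) |> w + (a |> v) <| c + (u <| b) <| c,
   nuR a b w + nuM a v c + nuL u b c).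

Definition semidirect_alg : assoc2Data k :=
  @Assoc2Data k semidirect_cat semidirect_bul semidirect_assoc.

Definition semidirect_D : functorData semidirect_alg semidirect_alg :=
  @FunctorData k semidirect_alg semidirect_alg
    (fun '(a, u) => (dop A a, Delta0 M u))
    (fun '(a, u, xi) => (dop A a, Delta0 M u, Delta1 M xi)).

Definition semidirect_Dnat (x y : A * M0 M) : A * M0 M * M1 M :=
  let: (a, u) := x in let: (b, v) := y in
  (dop A (a ** b), Delta0 M (a |> v + u <| b), thR M a v + thL M u b).

Definition semidirect : diff2Data k :=
  @Diff2Data k semidirect_alg semidirect_D semidirect_Dnat.

End Semidirect.

(* Main.v *)
Require Import Defs.
From mathcomp Require Import all_boot all_order all_algebra.

Set Implicit Arguments.
Unset Strict Implicit.
Unset Printing Implicit Defensive.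

Import GRing.Theory.
Local Open Scope ring_scope.

(** An arrow of the semidirect 2-vector space is an object (a, u) together with
an element xi of M_1, and composition adds the M_1-components.  Two composites
out of the same object are therefore equal as soon as the sums of their
M_1-components agree.  This turns the axioms of a difference associative
2-algebra into the axioms of a 2-term bimodule over (A, d):

- the values of delta on nu and theta say that the associator and the
  difference constraint have the prescribed targets ([tgt_assoc],
  [tgt_Dnat]);
- the values of nu and theta on the image of delta say that both are natural
  ([semidirect_assoc_natural], [semidirect_D_natural]);
- the equations in nu alone add up to the pentagon
  ([semidirect_is_assoc2]), those in theta and nu to the compatibility of the
  difference constraint with the associator
  ([semidirect_is_diff_operator]).

In each case the several bimodule axioms, one for each position of the module
argument, are the parts of the 2-algebra axiom that are linear in the
M_0-component (or in the M_1-component) of one of the arguments.  Adding these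
parts gives the whole axiom, up to an identity that holds in every abelian
group once all maps are expanded by additivity; [zmod] decides such identities.
The remaining conditions, invertibility included, follow from additivity and
from the fact that (a, u + delta xi, - xi) is an inverse of (a, u, xi). *)

(** * Identities in abelian groups *)

Inductive zmodTerm :=
  | ZAtom of nat
  | ZZero
  | ZAdd of zmodTerm & zmodTerm
  | ZOpp of zmodTerm.

Fixpoint zeval (V : zmodType) (e : seq V) (t : zmodTerm) : V :=
  match t with
  | ZAtom i => e`_i
  | ZZero => 0
  | ZAdd t1 t2 => zeval e t1 + zeval e t2
  | ZOpp t1 => - zeval e t1
  end.

(** The positive ([b = true]) and the negative ([b = false]) occurrences of an
atom are counted separately, so that the coefficients stay in [nat] and
compute. *)
Fixpoint zcount (t : zmodTerm) (b : bool) (i : nat) : nat :=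
  match t with
  | ZAtom j => b && (i == j)
  | ZZero => 0
  | ZAdd t1 t2 => zcount t1 b i + zcount t2 b i
  | ZOpp t1 => zcount t1 (~~ b) i
  end.

Definition zsame (n : nat) (t1 t2 : zmodTerm) : bool :=
  all (fun i => zcount t1 true i + zcount t2 false i
                == zcount t1 false i + zcount t2 true i)%N (iota 0 n).

Lemma zeval_count (V : zmodType) (e : seq V) (t : zmodTerm) :
  zeval e t
    = \sum_(i < size e) (e`_i *+ zcount t true i - e`_i *+ zcount t false i).
Proof.
elim: t => [j||t1 IH1 t2 IH2|t1 IH1] /=.
- under eq_bigr => i _ do rewrite mulr0n subr0.
  have [lt_j|ge_j] := ltnP j (size e).
    rewrite (bigD1 (Ordinal lt_j)) //= eqxx mulr1n big1 ?addr0 // => i ne_i.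
    rewrite (_ : (i == j :> nat) = false) //.
    by apply: contra_neqF ne_i => /eqP ?; apply/val_inj.
  rewrite nth_default // big1 // => i _.
  by rewrite [_ == _]ltn_eqF // (leq_trans (ltn_ord i)).
- by rewrite big1 // => i _; rewrite !mulr0n subr0.
- rewrite IH1 IH2 -big_split; apply: eq_bigr => i _ /=.
  by rewrite !mulrnDr opprD addrACA.
- by rewrite IH1 -sumrN; apply: eq_bigr => i _; rewrite opprB.
Qed.

Lemma zsameP (V : zmodType) (e : seq V) (t1 t2 : zmodTerm) :
  zsame (size e) t1 t2 -> zeval e t1 = zeval e t2.
Proof.
move=> /allP same; rewrite !zeval_count; apply: eq_bigr => i _.
have i_in : (i : nat) \in iota 0 (size e) by rewrite mem_iota add0n ltn_ord.
have /eqP eq_i := same i i_in.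
apply/eqP; rewrite subr_eq addrAC eq_sym subr_eq -!mulrnDr.
by rewrite eq_i addnC.
Qed.

(* Atoms are compared by [unify] and not syntactically: the same vector often
   occurs with different but convertible canonical structures in its type. *)
Local Ltac zatom x l :=
  lazymatch l with
  | ?y :: ?l' =>
    match goal with
    | _ => let _ := lazymatch goal with _ => unify x y end in
           constr:(Some 0%N)
    | _ => lazymatch zatom x l' with
           | Some ?n => constr:(Some n.+1)
           | None => constr:(@None nat)
           end
    end
  | _ => constr:(@None nat)
  end.

Local Ltac zatoms t l :=
  lazymatch t with
  | ?a + ?b => let l1 := zatoms a l in zatoms b l1
  | - ?a => zatoms a l
  | 0 => l
  | _ => lazymatch zatom t l with
         | Some _ => l
         | None => constr:(t :: l)
         end
  end.

Local Ltac zreify t l :=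
  lazymatch t with
  | ?a + ?b => let ta := zreify a l in let tb := zreify b l in
               constr:(ZAdd ta tb)
  | - ?a => let ta := zreify a l in constr:(ZOpp ta)
  | 0 => constr:(ZZero)
  | _ => lazymatch zatom t l with
         | Some ?n => constr:(ZAtom n)
         end
  end.

Local Ltac zmod :=
  lazymatch goal with
  | |- @eq ?T ?t1 ?t2 =>
    let l0 := zatoms t1 (@nil T) in
    let l := zatoms t2 l0 in
    let e1 := zreify t1 l in
    let e2 := zreify t2 l in
    refine (@zsameP _ l e1 e2 _); vm_compute; reflexivity
  end.

(** Reduces an equation to a known one with the same difference of sides; the
remaining condition is an identity between sums, within reach of [zmod]. *)
Lemma eq_from (V : zmodType) (x y x' y' : V) :
  x' = y' -> x + y' = x' + y -> x = y.
Proof. by move=> ->; rewrite addrC => /addrI. Qed.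

Lemma eqD (V : zmodType) (x y x' y' : V) :
  x = y -> x' = y' -> x + x' = y + y'.
Proof. by move=> -> ->. Qed.

(** * Trilinear maps and composition *)

Lemma trilinearD (k : fieldType) (U V W X : lmodType k) (f : U -> V -> W -> X) :
  trilinear f ->
  (forall u u' v w, f (u + u') v w = f u v w + f u' v w) *
  (forall u v v' w, f u (v + v') w = f u v w + f u v' w) *
  (forall u v w w', f u v (w + w') = f u v w + f u v w').
Proof.
case=> lin1 lin2 lin3; split; first split=> [u u' v w|u v v' w];
  last move=> u v w w'.
- by have := lin1 v w 1 u u'; rewrite !scale1r.
- by have := lin2 u w 1 v v'; rewrite !scale1r.
- by have := lin3 u v 1 w w'; rewrite !scale1r.
Qed.

Lemma trilinearP (k : fieldType) (U V W X : lmodType k) (f : U -> V -> W -> X) :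
  trilinear f ->
  (forall r u u' v w, f (r *: u + u') v w = r *: f u v w + f u' v w) *
  (forall r u v v' w, f u (r *: v + v') w = r *: f u v w + f u v' w) *
  (forall r u v w w', f u v (r *: w + w') = r *: f u v w + f u v w').
Proof.
case=> lin1 lin2 lin3; split; first split=> *; last move=> *.
- exact: lin1.
- exact: lin2.
- exact: lin3.
Qed.

Lemma compo_vcomp (k : fieldType) (C : twoVectData k) (g f : mor C)
  (gf : tgt f = src g) : compo g f = vcomp gf.
Proof.
by rewrite /compo; case: eqP => // gf'; rewrite (eq_irrelevance gf' gf).
Qed.

Lemma compo_prod (k : fieldType) (C C' : twoVectData k)
    (g f : mor (prodTwoVect C C')) :
  tgt f = src g -> compo g f = (compo g.1 f.1, compo g.2 f.2).
Proof.
move=> gf; rewrite (compo_vcomp gf) /=.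
by rewrite (compo_vcomp (congr1 fst gf)) (compo_vcomp (congr1 snd gf)).
Qed.

Section Semidirect.
Variables (k : fieldType) (A : diffAlg k) (M : diffBimod2 A).

Local Notation cat := (semidirect_cat M).
Local Notation alg := (semidirect_alg M).
Local Notation dalg := (semidirect M).
Local Notation D0 := (fob (Dop dalg)).
Local Notation D1 := (fmor (Dop dalg)).

Let nuR_D := trilinearD (nuR_trilinear M).
Let nuM_D := trilinearD (nuM_trilinear M).
Let nuL_D := trilinearD (nuL_trilinear M).
Let nuR_P := trilinearP (nuR_trilinear M).
Let nuM_P := trilinearP (nuM_trilinear M).
Let nuL_P := trilinearP (nuL_trilinear M).

(* The last simplification matters: expanding [- (x + y)] by [linearD] leaves
   the opposite wrapped in a linear map, which [zmod] would take for an atom. *)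
Local Ltac additive :=
  rewrite /= ?(linear0l, linear0r, linear0)
    ?(linearDl, linearDr, linearD, linearZl_LR, linearZr_LR, linearZ_LR)
    ?(nuR_D, nuM_D, nuL_D) ?scalerDr /=;
  zmod.

(** * The semidirect 2-vector space *)

Lemma srcE (f : mor cat) : src f = f.1.
Proof. by case: f => [[]]. Qed.

Lemma semidirect_compo (g f : mor cat) :
  tgt f = src g -> compo g f = (src f, f.2 + g.2).
Proof. by move=> gf; rewrite compo_vcomp srcE. Qed.

Lemma semidirect_twoVect : is_twoVect cat.
Proof.
have comp := semidirect_compo; split.
- by move=> r [[a u] xi] [[b v] eta].
- by move=> r [[a u] xi] [[b v] eta] /=; congr (_, _); additive.
- by move=> r [a u] [b v] /=; congr (_, _); additive.
- by case.
- by case=> a u /=; rewrite linear0 addr0.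
- by move=> g f gf; rewrite comp //; case: f gf => [[a u] xi].
- move=> [[a u] xi] [[b v] eta] gf; rewrite comp //=.
  by case: gf => -> <-; rewrite linearD addrA.
- move=> r [[a u] xi] [[b v] eta] [[a' u'] xi'] [[b' v'] eta'] gf gf'.
  rewrite !comp //; first by congr (_, _); additive.
  by move: gf gf' => /= [-> <-] [-> <-]; congr (_, _); additive.
- by move=> [[a u] xi]; rewrite comp /= ?add0r //; rewrite linear0 addr0.
- by move=> [[a u] xi]; rewrite comp /= ?addr0.
- move=> h g f gf hg.
  have tgt_gf : tgt (compo g f) = src h.
    rewrite -hg comp //=; case: f g gf hg => [[a u] xi] [[b v] eta] /=.
    by move=> [-> <-] _; rewrite linearD addrA.
  have src_hg : tgt f = src (compo h g).
    by rewrite gf comp //; case: g {gf hg tgt_gf} => [[]].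
  rewrite (comp _ _ tgt_gf) (comp _ _ src_hg) !comp //= addrA.
  by case: f {gf src_hg tgt_gf} => [[a u] xi].
Qed.

Lemma semidirect_compo3 (h g f : mor cat) :
  tgt f = src g -> tgt g = src h ->
  compo h (compo g f) = (src f, f.2 + g.2 + h.2).
Proof.
move=> gf gh; rewrite [LHS]semidirect_compo.
  by rewrite (src_compo semidirect_twoVect gf) semidirect_compo.
by rewrite (tgt_compo semidirect_twoVect gf).
Qed.

Lemma semidirect_inv (f : mor cat) :
  exists g : mor cat, [/\ src g = tgt f, tgt g = src f,
    compo g f = idm cat (src f) & compo f g = idm cat (tgt f)].
Proof.
case: f => [[a u] xi]; exists (a, u + delta M xi, - xi).
have tgt_inv : u + delta M xi + delta M (- xi) = u by rewrite linearN addrK.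
by split; rewrite /= ?tgt_inv // semidirect_compo /= ?tgt_inv ?subrr ?addNr.
Qed.

(** Every arrow is invertible, and both sides of a naturality square start at
the same object; so only the M_1-components have to be compared. *)
Lemma semidirect_natural_iso (C : twoVectData k) (F G : functorData C cat)
    (alpha : ob C -> mor cat) :
  (forall f, src (fmor F f) = fob F (src f)) ->
  (forall f, tgt (fmor F f) = fob F (tgt f)) ->
  (forall f, src (fmor G f) = fob G (src f)) ->
  (forall x, src (alpha x) = fob F x) ->
  (forall x, tgt (alpha x) = fob G x) ->
  (forall f : mor C, (alpha (src f)).2 + (fmor G f).2
                     = (fmor F f).2 + (alpha (tgt f)).2) ->
  is_natural_iso F G alpha.
Proof.
move=> srcF tgtF srcG alpha_src alpha_tgt square; split=> // [f|x].
  rewrite !semidirect_compo ?srcG ?tgtF ?alpha_src ?alpha_tgt //.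
  by rewrite -square srcF.
by have [g] := semidirect_inv (alpha x); rewrite alpha_src alpha_tgt; exists g.
Qed.

(** * The associative 2-algebra *)

Lemma semidirect_bul_bilinear : is_bilinear_functor (semidirect_bul M).
Proof.
split; first split.
- by move=> [[[a u] xi] [[b v] eta]].
- move=> [[[a u] xi] [[b v] eta]] /=; congr (_, _).
  by rewrite !linearD delta_lact delta_ract; additive.
- by move=> [[a u] [b v]]; congr (_, _); additive.
- move=> [[[a u] xi] [[b v] eta]] [[[a' u'] xi'] [[b' v'] eta']] gf.
  rewrite compo_prod //; case: (gf) => /= *; subst.
  rewrite !semidirect_compo //=; first by congr (_, _); additive.
  by congr (_, _); rewrite !linearD delta_lact delta_ract; additive.
- by split=> [[b v]|[a u]] r [a' u'] [b' v']; congr (_, _); additive.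
- by split=> [[[b v] eta]|[[a u] xi]] r [[a' u'] xi'] [[b' v'] eta'];
    congr (_, _, _); additive.
Qed.

Lemma src_bul (f g : mor alg) : src (bul1 f g) = bul0 (src f) (src g).
Proof.
by have [[bul_src _ _ _] _ _] := semidirect_bul_bilinear; apply: (bul_src (f, g)).
Qed.

Lemma tgt_bul (f g : mor alg) : tgt (bul1 f g) = bul0 (tgt f) (tgt g).
Proof.
by have [[_ bul_tgt _ _] _ _] := semidirect_bul_bilinear; apply: (bul_tgt (f, g)).
Qed.

Lemma src_one (x : ob alg) : src (idm alg x) = x.
Proof. exact: (src_idm semidirect_twoVect). Qed.

Lemma tgt_one (x : ob alg) : tgt (idm alg x) = x.
Proof. exact: (tgt_idm semidirect_twoVect). Qed.

Lemma src_assoc (x y z : ob alg) : src (assoc x y z) = bul0 (bul0 x y) z.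
Proof.
by case: x y z => [a u] [b v] [c w]; rewrite /bul0 /=; congr (_, _); additive.
Qed.

(** In A this is associativity; in M_0, delta nu is by its defining equations
the difference between the two bracketings. *)
Lemma tgt_assoc (x y z : ob alg) : tgt (assoc x y z) = bul0 x (bul0 y z).
Proof.
case: x y z => [a u] [b v] [c w]; rewrite /bul0 /= amulA; congr (_, _).
by apply: (eq_from (esym (eqD (eqD (delta_nuR a b w) (delta_nuM a v c))
                              (delta_nuL u b c)))); additive.
Qed.

(* From here on sources and targets are computed by rewriting with the lemmas
   above, which apply only as long as [src] and [tgt] are not unfolded. *)
Local Arguments src : simpl never.
Local Arguments tgt : simpl never.

Lemma semidirect_assoc_natural :
  is_natural_iso (bul_l alg) (bul_r alg) (fun p => assoc p.1.1 p.1.2 p.2).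
Proof.
apply: semidirect_natural_iso => //=.
- by move=> f; rewrite !src_bul.
- by move=> f; rewrite !tgt_bul.
- by move=> f; rewrite !src_bul.
- by move=> x; rewrite src_assoc.
- by move=> x; rewrite tgt_assoc.
(* Passing from source to target changes nu by its value on delta of the
   M_1-components, and this value is the failure of associativity on M_1. *)
move=> [[[[a u] xi] [[b v] eta]] [[c w] zeta]]; rewrite /bul1 /=.
by apply: (eq_from (eqD (eqD (nuR_delta a b zeta) (nuM_delta a eta c))
                        (nuL_delta xi b c))); additive.
Qed.

(** The pentagon is the sum of the four cocycle equations for nu, one for each
position of the module element among the four arguments. *)
Lemma semidirect_is_assoc2 : is_assoc2 alg.
Proof.
split.
- exact: semidirect_twoVect.
- exact: semidirect_bul_bilinear.
- by split=> [[b v] [c w]|[a u] [c w]|[a u] [b v]] r [a' u'] [b' v'];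
    congr (_, _, _); rewrite ?(nuR_P, nuM_P, nuL_P); additive.
- exact: semidirect_assoc_natural.
- move=> x y z t.
  rewrite semidirect_compo3 ?semidirect_compo
    ?(tgt_bul, src_bul, tgt_assoc, src_assoc, src_one, tgt_one) //.
  congr (_, _); case: x y z t => [a u] [b v] [c w] [e p].
  (* [nu_MAAA] has the opposite sign: its first term comes from the right-hand
     side of the pentagon, those of the other three from the left-hand side. *)
  by apply: (eq_from (eqD (eqD (nu_AAAM a b c p) (nu_AAMA a b w e))
    (eqD (nu_AMAA a v c e) (esym (nu_MAAA u b c e))))); additive.
Qed.

(** * The difference operator *)

Lemma src_D (f : mor dalg) : src (D1 f) = D0 (src f).
Proof. by case: f => [[a u] xi]. Qed.

Lemma tgt_D (f : mor dalg) : tgt (D1 f) = D0 (tgt f).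
Proof.
by case: f => [[a u] xi]; congr (_, _); rewrite linearD Delta_delta.
Qed.

Lemma semidirect_D_linear : is_linear_functor (Dop dalg).
Proof.
split; first split.
- exact: src_D.
- exact: tgt_D.
- by case=> a u; congr (_, _); additive.
- move=> g f gf; rewrite !semidirect_compo ?src_D ?tgt_D ?gf //.
  by case: g f {gf} => [[a u] xi] [[b v] eta]; congr (_, _); additive.
- by move=> r [a u] [b v]; congr (_, _); additive.
- by move=> r [[a u] xi] [[b v] eta]; congr (_, _, _); additive.
Qed.

Lemma src_Dnat (x y : ob dalg) : src (Dnat x y) = D0 (bul0 x y).
Proof. by case: x y => [a u] [b v]. Qed.

(** In A this is the difference Leibniz rule of d; in M_0, delta theta is the
defect of that rule for Delta_0. *)
Lemma tgt_Dnat (x y : ob dalg) :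
  tgt (Dnat x y) = bul0 (D0 x) y + bul0 x (D0 y) + bul0 (D0 x) (D0 y).
Proof.
case: x y => [a u] [b v]; rewrite /tgt /bul0 /=; congr (_, _); first exact: dopM.
by apply: (eq_from (esym (eqD (delta_thR a v) (delta_thL u b)))); additive.
Qed.

Lemma srcD (f g : mor dalg) : src (f + g) = src f + src g.
Proof. by case: f g => [[a u] xi] [[b v] eta]. Qed.

Lemma tgtD (f g : mor dalg) : tgt (f + g) = tgt f + tgt g.
Proof. by case: f g => [[a u] xi] [[b v] eta]; congr (_, _); additive. Qed.

Lemma bul0Dl (x y z : ob dalg) : bul0 (x + y) z = bul0 x z + bul0 y z.
Proof. by case: x y z => [a u] [b v] [c w]; congr (_, _); additive. Qed.

Lemma bul0Dr (x y z : ob dalg) : bul0 x (y + z) = bul0 x y + bul0 x z.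
Proof. by case: x y z => [a u] [b v] [c w]; congr (_, _); additive. Qed.

Lemma semidirect_D_natural :
  is_natural_iso (D_bul dalg) (bul_D dalg) (fun p => Dnat p.1 p.2).
Proof.
apply: semidirect_natural_iso => //=.
- by move=> f; rewrite src_D src_bul.
- by move=> f; rewrite tgt_D tgt_bul.
- by move=> f; rewrite !srcD !src_bul !src_D.
- by move=> x; rewrite src_Dnat.
- by move=> x; rewrite tgt_Dnat.
(* As for the associator: theta on the image of delta is the defect of the
   difference Leibniz rule for Delta_1. *)
move=> [[[a u] xi] [[b v] eta]]; rewrite /bul1 /=.
by apply: (eq_from (eqD (thR_delta a eta) (thL_delta xi b))); additive.
Qed.

(** The coherence condition is the sum of the three equations that relate theta
to nu, one for each position of the module element among the arguments. *)
Lemma semidirect_is_diff_operator : is_diff_operator dalg.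
Proof.
split.
- exact: semidirect_D_linear.
- by split=> [[b v]|[a u]] r [a' u'] [b' v']; congr (_, _, _); additive.
- exact: semidirect_D_natural.
- move=> x y z.
  (* One composability condition survives: its two sides are the same seven
     products, bracketed differently. *)
  rewrite !semidirect_compo3
    ?(srcD, tgtD, src_bul, tgt_bul, src_assoc, tgt_assoc, src_one, tgt_one,
      src_D, tgt_D, src_Dnat, tgt_Dnat, bul0Dl, bul0Dr) //; last by zmod.
  congr (_, _); case: x y z => [a u] [b v] [c w].
  by apply: (eq_from (esym (eqD (eqD (th_AAM a b w) (th_AMA a v c))
                                (th_MAA u b c)))); additive.
Qed.

End Semidirect.

Theorem proposition5p9 (k : fieldType) (k_char0 : [pchar k]%R =i pred0)
    (A : diffAlg k) (M : diffBimod2 A) :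
  is_diff_assoc2 (semidirect M).
Proof.
split; [exact: semidirect_is_assoc2 | exact: semidirect_is_diff_operator].
Qed.
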